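(* Let $\mathfrak{g}$ be a (finite-dimensional) simple real Lie algebra and let $\mathfrak{g}=\mathfrak{k}\oplus\mathfrak{p}$ be a Cartan decomposition of $\mathfrak{g}$. Let $\mathfrak{p}\ltimes_{\mathrm{ad}}\mathfrak{k}$ be the semidirect product of the Lie algebra $\mathfrak{k}$ with the vector space $\mathfrak{p}$, regarded as an abelian Lie algebra (abelian ideal), relative to the adjoint action of $\mathfrak{k}$ on $\mathfrak{p}$. Then $\mathfrak{g}$ and $\mathfrak{p}\ltimes_{\mathrm{ad}}\mathfrak{k}$ have the same index: $$\operatorname{ind}(\mathfrak{g})=\operatorname{ind}(\mathfrak{p}\ltimes_{\mathrm{ad}}\mathfrak{k}).$$
   Context: For a finite-dimensional Lie algebra $\mathfrak{l}$ and $\ell\in\mathfrak{l}^*$, put $\mathfrak{l}^\ell=\{x\in\mathfrak{l}:\langle\ell,[x,y]\rangle=0\text{ for all }y\in\mathfrak{l}\}$. The index of $\mathfrak{l}$ is $\operatorname{ind}(\mathfrak{l})=\min_{\ell\in\mathfrak{l}^*}\dim\mathfrak{l}^\ell$. The bracket of $\mathfrak{p}\ltimes_{\mathrm{ad}}\mathfrak{k}$, whose underlying space is $\mathfrak{p}\times\mathfrak{k}$, is $[(p,k),(p',k')]=([k,p']-[k',p],[k,k'])$, where the brackets on the right are those of $\mathfrak{g}$. *)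

(* Defs.v *)
From HB Require Import structures.
From mathcomp Require Import all_boot all_order all_algebra.
From mathcomp Require Import boolp reals.

Set Implicit Arguments.
Unset Strict Implicit.
Unset Printing Implicit Defensive.

Import Order.TTheory GRing.Theory Num.Theory passmx.
Local Open Scope ring_scope.

HB.mixin Record Vector_isLieAlgebra (K : fieldType) (L : Type)
    of Vector K L := {
  lie : L -> L -> L;
  lie_linearl : forall y, linear (lie^~ y);
  lie_linearr : forall x, linear (lie x);
  liexx : forall x, lie x x = 0;
  lie_jacobi : forall x y z,
    lie x (lie y z) + lie y (lie z x) + lie z (lie x y) = 0 }.

(* Finite-dimensional Lie algebras: the carrier is a vectType. *)
#[short(type="lieAlgType")]
HB.structure Definition LieAlgebra (K : fieldType) :=
  { L of Vector K L & Vector_isLieAlgebra K L }.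

Notation "⁅ x , y ⁆" := (lie x y) (format "⁅ x ,  y ⁆") : ring_scope.

Section LieAlgebraTheory.
Context {K : fieldType} {L : lieAlgType K}.
Implicit Types (x y z : L) (f : 'Hom(L, K^o)) (U : {vspace L}).

HB.instance Definition _ x := GRing.isLinear.Build K L L *:%R (lie x)
  (lie_linearr x).

Lemma lieDl x y z : ⁅x + y, z⁆ = ⁅x, z⁆ + ⁅y, z⁆.
Proof. by rewrite -[x]scale1r lie_linearl !scale1r. Qed.

Lemma lie0l z : ⁅0, z⁆ = 0 :> L.
Proof. by apply: (addrI ⁅0, z⁆); rewrite -lieDl !addr0. Qed.

Lemma lieZl (a : K) x z : ⁅a *: x, z⁆ = a *: ⁅x, z⁆.
Proof. by rewrite -[a *: x]addr0 lie_linearl lie0l addr0. Qed.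

Lemma lieNl x z : ⁅- x, z⁆ = - ⁅x, z⁆.
Proof. by rewrite -scaleN1r lieZl scaleN1r. Qed.

Lemma lieC x y : ⁅x, y⁆ = - ⁅y, x⁆.
Proof.
have := liexx (x + y); rewrite lieDl !linearD/= !liexx add0r addr0.
by move=> /eqP; rewrite addr_eq0 => /eqP.
Qed.

Definition ad x : 'End(L) := linfun (lie x).

Lemma adE x y : ad x y = ⁅x, y⁆.
Proof. by rewrite lfunE. Qed.

Lemma ad_linear : linear ad.
Proof.
move=> a x y; apply/lfunP => z.
by rewrite add_lfunE scale_lfunE !adE lieDl lieZl.
Qed.

(* The annihilator L^f, as the kernel of x |-> (y |-> f [x, y]). *)
Definition lie_stab f : {vspace L} :=
  lker (linfun (fun x => (f \o ad x)%VF) : 'Hom(L, 'Hom(L, K^o))).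

Lemma lie_stabP f x : reflect (forall y, f ⁅x, y⁆ = 0) (x \in lie_stab f).
Proof.
have lin : linear (fun x => (f \o ad x)%VF : 'Hom(L, K^o)).
  by move=> a u v; rewrite ad_linear comp_lfunDr comp_lfunZr.
pose h := HB.pack_for {linear L -> 'Hom(L, K^o)}
  (fun x => (f \o ad x)%VF : 'Hom(L, K^o)) (GRing.isLinear.Build _ _ _ _ _ lin).
rewrite memv_ker -[X in linfun X]/(h : _ -> _) lfunE/=.
apply: (iffP eqP) => [fx0 y | fx0]; last first.
  by apply/lfunP => y; rewrite comp_lfunE adE fx0 zero_lfunE.
by have /lfunP/(_ y) := fx0; rewrite comp_lfunE adE zero_lfunE.
Qed.

Lemma lie_stab_dim_exists :
  exists n, `[< exists f : 'Hom(L, K^o), \dim (lie_stab f) = n >].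
Proof. by exists (\dim (lie_stab 0)); apply/asboolP; exists 0. Qed.

Definition is_ideal U := forall x y, y \in U -> ⁅x, y⁆ \in U.

Definition is_subalgebra U := forall x y, x \in U -> y \in U -> ⁅x, y⁆ \in U.

(* B(x, y) = tr (ad x o ad y), the trace being taken in a basis of L. *)
Definition killing x y : K :=
  \tr (mxof (vbasis fullv) (vbasis fullv) (ad x \o ad y)%VF).

End LieAlgebraTheory.

Definition lie_index (K : fieldType) (L : lieAlgType K) : nat :=
  ex_minn (lie_stab_dim_exists (L := L)).

Definition lie_simple (K : fieldType) (L : lieAlgType K) : Prop :=
  (exists x y : L, ⁅x, y⁆ != 0) /\
  (forall I : {vspace L}, is_ideal I -> I = 0%VS \/ I = fullv).

Section CartanDecomposition.
Context {R : realType} {g : lieAlgType R}.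
Implicit Types (theta : 'End(g)) (k p : {vspace g}).

Definition cartan_involution theta : Prop :=
  [/\ forall x y, theta ⁅x, y⁆ = ⁅theta x, theta y⁆,
      forall x, theta (theta x) = x
    & forall x, x != 0 -> 0 < - killing x (theta x)].

Definition cartan_decomposition k p : Prop :=
  exists2 theta, cartan_involution theta
    & k = leigenspace theta 1 /\ p = leigenspace theta (- 1).

Lemma mem_leigenspace theta a x :
  (x \in leigenspace theta a) = (theta x == a *: x).
Proof.
by rewrite memv_ker add_lfunE opp_lfunE scale_lfunE id_lfunE subr_eq0.
Qed.

Lemma cartan_subalgebra k p : cartan_decomposition k p -> is_subalgebra k.
Proof.
move=> [theta [thM _ _] [-> _]] x y; rewrite !mem_leigenspace !scale1r.
by move=> /eqP xk /eqP yk; rewrite thM xk yk.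
Qed.

Lemma cartan_ad_stable k p : cartan_decomposition k p ->
  forall x y, x \in k -> y \in p -> ⁅x, y⁆ \in p.
Proof.
move=> [theta [thM _ _] [-> ->]] x y; rewrite !mem_leigenspace !scale1r !scaleN1r.
by move=> /eqP xk /eqP yp; rewrite thM xk yp linearN.
Qed.

Lemma cartan_directv k p : cartan_decomposition k p ->
  (k + p)%VS = fullv /\ (k :&: p)%VS = 0%VS.
Proof.
move=> [theta [_ thK _] [-> ->]]; split; apply/eqP.
- rewrite eqEsubv subvf/=; apply/subvP => x _.
  have -> : x = 2^-1 *: (x + theta x) + 2^-1 *: (x - theta x).
    rewrite -scalerDr addrACA subrr addr0 -mulr2n -scaler_nat scalerA.
    by rewrite mulVf ?pnatr_eq0// scale1r.
  apply: memv_add; rewrite memvZ// mem_leigenspace linearD ?linearN/= thK.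
    by rewrite scale1r addrC.
  by rewrite scaleN1r opprB addrC.
- rewrite -subv0; apply/subvP => x; rewrite memv_cap !mem_leigenspace memv0.
  case/andP=> /eqP-> /eqP; rewrite scale1r scaleN1r => /eqP.
  by rewrite -subr_eq0 opprK -mulr2n -scaler_nat scaler_eq0 pnatr_eq0.
Qed.

End CartanDecomposition.

(* The carrier of the semidirect product of k and the abelian ideal p; the two
   proofs are parameters only so that the Lie algebra structure below can be
   attached to this type. *)
Definition semidirect (K : fieldType) (g : lieAlgType K) (p k : {vspace g})
    (kk : is_subalgebra k)
    (kp : forall x y : g, x \in k -> y \in p -> ⁅x, y⁆ \in p) : Type :=
  (subvs_of p * subvs_of k)%type.

Section SemidirectProduct.
Context (K : fieldType) (g : lieAlgType K) (p k : {vspace g}).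
Context (kk : is_subalgebra k).
Context (kp : forall x y : g, x \in k -> y \in p -> ⁅x, y⁆ \in p).
Local Notation S := (semidirect kk kp).

HB.instance Definition _ := Vector.on S.

(* The projections are harmless: their arguments already lie in p and k. *)
Definition semidirect_lie (u v : S) : S :=
  (vsproj p (⁅vsval u.2, vsval v.1⁆ - ⁅vsval v.2, vsval u.1⁆),
   vsproj k ⁅vsval u.2, vsval v.2⁆).

Lemma semidirect_lie1 u v : vsval (semidirect_lie u v).1 =
  ⁅vsval u.2, vsval v.1⁆ - ⁅vsval v.2, vsval u.1⁆.
Proof. by rewrite vsprojK// memvB// kp ?subvsP. Qed.

Lemma semidirect_lie2 u v :
  vsval (semidirect_lie u v).2 = ⁅vsval u.2, vsval v.2⁆.
Proof. by rewrite vsprojK// kk ?subvsP. Qed.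

Let ext (u v : S) : vsval u.1 = vsval v.1 -> vsval u.2 = vsval v.2 -> u = v.
Proof. by case: u v => [a b] [c d] /= /subvs_inj-> /subvs_inj->. Qed.

Let pD (u v : S) : vsval (u + v).1 = vsval u.1 + vsval v.1. Proof. by []. Qed.
Let kD (u v : S) : vsval (u + v).2 = vsval u.2 + vsval v.2. Proof. by []. Qed.
Let pZ a (u : S) : vsval (a *: u).1 = a *: vsval u.1.
Proof. exact: linearZ. Qed.
Let kZ a (u : S) : vsval (a *: u).2 = a *: vsval u.2.
Proof. exact: linearZ. Qed.
Let pN (u : S) : vsval (- u).1 = - vsval u.1. Proof. exact: linearN. Qed.
Let kN (u : S) : vsval (- u).2 = - vsval u.2. Proof. exact: linearN. Qed.
Let p0 : vsval (0 : S).1 = 0. Proof. exact: linear0. Qed.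
Let k0 : vsval (0 : S).2 = 0. Proof. exact: linear0. Qed.
Let pkE := (semidirect_lie1, semidirect_lie2, pD, kD, pZ, kZ, pN, kN, p0, k0).

Fact semidirect_liexx u : semidirect_lie u u = 0.
Proof. by apply: ext; rewrite !pkE ?liexx ?subrr. Qed.

Fact semidirect_linearl v : linear (semidirect_lie^~ v).
Proof.
move=> a u w; apply: ext; rewrite !pkE !lieDl !lieZl//.
by rewrite linearD linearZ/= scalerBr opprD addrACA.
Qed.

Fact semidirect_linearr u : linear (semidirect_lie u).
Proof.
have C v w : semidirect_lie v w = - semidirect_lie w v.
  by apply: ext; rewrite !pkE ?opprB// lieC.
by move=> a v w; rewrite C semidirect_linearl !(C u) opprD scalerN.
Qed.

Fact semidirect_jacobi u v w :
  semidirect_lie u (semidirect_lie v w) + semidirect_lie v (semidirect_lie w u)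
  + semidirect_lie w (semidirect_lie u v) = 0.
Proof.
have act (x y z : g) : ⁅⁅x, y⁆, z⁆ = ⁅x, ⁅y, z⁆⁆ - ⁅y, ⁅x, z⁆⁆.
  have /eqP := lie_jacobi x y z; rewrite addr_eq0 => /eqP J.
  by rewrite [LHS]lieC -J [⁅z, x⁆]lieC linearN.
apply: ext; rewrite !pkE; last exact: lie_jacobi.
rewrite !linearB/= !act !opprB !addrA.
rewrite (ACl ((1*12)*(2*7)*(3*10)*(4*5)*(6*11)*(8*9)))/=.
by rewrite !subrr !addNr !addr0.
Qed.

HB.instance Definition _ := Vector_isLieAlgebra.Build K S
  semidirect_linearl semidirect_linearr semidirect_liexx semidirect_jacobi.

End SemidirectProduct.

(* Main.v *)
Require Import Defs.
From HB Require Import structures.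
From mathcomp Require Import all_boot all_order all_algebra.
From mathcomp Require Import boolp reals.
From mathcomp Require Import complex.

(* Rescaling p by c turns the bracket of g into c ^+ 2 [p, p] + (the bracket of
   the semidirect product), so semicontinuity of the rank at c = 0 gives
   ind g <= ind (p x| k).

   Conversely, let A be maximal abelian in p, T maximal abelian in the
   centralizer of A in k, and a in A, b in T generic.  Since the Killing form is
   definite on k and on p, the stabilizer of (a, b) in the semidirect product
   lies in A x T.  On the other hand every centralizer in g has dimension at
   least dim (A + T): the gradients of the invariants tr (ad z ^+ j) commute
   with z, so for z on a generic point of a line through a + b the centralizer
   of z is at least as large as the span of these gradients at a + b; this span
   has dimension dim (A + T) because the operators ad y, y in A + T, are
   simultaneously diagonalizable over the complex numbers and ad (a + b)
   separates their common weights. *)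

Set Implicit Arguments.
Unset Strict Implicit.
Unset Printing Implicit Defensive.

Import Order.TTheory GRing.Theory Num.Theory passmx.
Local Open Scope ring_scope.

(** * Polynomial genericity: semicontinuity of the rank and avoidance of hyperplanes *)

(** With [P] and [Q] one-sided inverses of the two rank factors at [t0], [d] is the determinant of
    the square matrix [P *m M *m Q]. It equals 1 at [t0], and wherever it is nonzero [M] has at
    least the size of that square as rank. *)
Lemma mxrank_horner_semicontinuous (F : fieldType) m n (M : 'M[{poly F}]_(m, n)) t0 :
  exists2 d : {poly F}, d.[t0] != 0 &
    forall t, d.[t] != 0 ->
      (\rank (map_mx (horner_eval t0) M) <= \rank (map_mx (horner_eval t) M))%N.
Proof.
set A := map_mx _ M.
have /row_fullP[P PA] := col_base_full A.
have /row_freeP[Q AQ] := row_base_free A.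
pose d := \det (map_mx polyC P *m M *m map_mx polyC Q).
have dE t : d.[t] = \det (P *m map_mx (horner_eval t) M *m Q).
  rewrite -[LHS]/(horner_eval t d) -det_map_mx !map_mxM -!map_mx_comp.
  by congr (\det (_ *m _ *m _));
  apply/matrixP => i j; rewrite !mxE /= horner_evalE hornerC.
exists d => [|t].
  have : P *m (col_base A *m row_base A) *m Q = 1%:M by rewrite mulmxA PA mul1mx AQ.
  by rewrite mulmx_base dE -/A => ->; rewrite det1 oner_neq0.
rewrite dE -unitfE -/(_ \in unitmx) => /mxrank_unit e.
rewrite -[leqLHS]e.
by rewrite (leq_trans (mxrankM_maxl _ _)) ?mxrankM_maxr.
Qed.

(** The numbers 1, 2, 3, ... are pairwise distinct, so they cannot all be roots. Starting at 1 keeps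
    the point nonzero, as needed when it serves as a scaling factor. *)
Lemma exists_nonroot (R : numDomainType) (d : {poly R}) :
  d != 0 -> exists k : nat, d.[k.+1%:R] != 0.
Proof.
move=> dn0; apply: contrapT => /forallNP H.
have rootd k : root d k.+1%:R by apply/negPn/negP => /H.
suff : (size d < size d)%N by rewrite ltnn.
rewrite -{1}(size_mkseq (fun k => k.+1%:R : R) (size d)); apply: max_poly_roots => //.
  by apply/allP => _ /mapP[k _ ->].
by rewrite mkseq_uniq// => i j /eqP; rewrite eqr_nat eqSS => /eqP.
Qed.

(** Induction on the list of maps: if the new [phi i] kills [z] but not some [y] in [H], then [z] is
    replaced by [y] plus a suitable multiple of [z]. Only additivity is asked because the maps will
    be complex valued weights on a real space. *)
Lemma additive_avoidance (V : zmodType) (C : numDomainType) (H : V -> Prop)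
    (I : finType) (phi : I -> V -> C) :
  H 0 -> (forall x y, H x -> H y -> H (x + y)) ->
  (forall i x y, phi i (x + y) = phi i x + phi i y) ->
  exists2 z, H z & forall i, phi i z = 0 -> forall y, H y -> phi i y = 0.
Proof.
move=> H0 HD phiD.
have phiM i x k : phi i (x *+ k) = phi i x *+ k.
  elim: k => [|k IH]; last by rewrite !mulrS phiD IH.
  by apply: (addrI (phi i 0)); rewrite -phiD !addr0.
have HM x k : H x -> H (x *+ k).
  by move=> Hx; elim: k => [|k IH]; rewrite ?mulrS//; apply: HD.
suff: forall s : seq I,
    exists2 z, H z & {in s, forall i, phi i z = 0 -> forall y, H y -> phi i y = 0}.
  by case/(_ (enum I)) => z Hz h; exists z => // i; apply: h; rewrite mem_enum.
elim=> [|i s [z Hz zP]]; first by exists 0.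
have [[y [Hy iz iy]]|/forallNP no] :=
    pselect (exists y, [/\ H y, phi i z = 0 & phi i y != 0]); last first.
  exists z => // j; rewrite inE => /predU1P[->|/zP//] z0 y Hy.
  by apply/eqP/negPn/negP => yn0; apply: (no y).
(* j is bad for y + k z for at most one k, the root of phi j y + 'X * phi j z *)
pose P : {poly C} := \prod_(j <- s | phi j z != 0) ((phi j y)%:P + (phi j z) *: 'X).
have [|k kP] := @exists_nonroot _ P.
  rewrite /P; elim/big_rec: _ => [|j p jz pn0]; first exact: oner_neq0.
  rewrite mulf_neq0//; apply: contraNneq jz => /(congr1 (coefp 1)) /=.
  by rewrite !coefE /= add0r mulr1 => ->.
exists (y + z *+ k.+1); first exact: HD Hy (HM _ _ Hz).
move=> j; rewrite inE phiD phiM => /predU1P[->|js] e.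
  by move: iy e; rewrite iz mul0rn addr0 => /eqP.
apply: zP => //; apply/eqP/negPn/negP => jz; move: kP.
rewrite /P horner_prod (big_rem j)//= jz !hornerE mulr_natr e mul0r eqxx//.
Qed.


(** * Diagonalizability from a positive definite form *)

Section Diagonalizable.
Local Open Scope sesquilinear_scope.

(* With [S = T^t* *m T], the conjugate of [A] by [T^t*] is normal. *)
Lemma diagonalizable_selfadjoint_up_to_scalar (C : numClosedFieldType) n
    (S A : 'M[C]_n) (c : C) :
  S ^t* = S -> (forall v : 'rV_n, v != 0 -> 0 < (v *m S *m v ^t*) 0 0) ->
  A *m S = c *: (S *m A ^t*) -> diagonalizable A.
Proof.
move=> Sherm Spos AS.
have Snormal : S \is normalmx by apply/normalmxP; rewrite Sherm.
set U := spectralmx S; set d := spectral_diag S.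
have Uu : U \is unitarymx by apply: spectral_unitarymx.
have Uunit : U \in unitmx := unitarymx_unit Uu.
have SE : S = invmx U *m diag_mx d *m U by apply/orthomx_spectralP.
have d_gt0 i : 0 < d 0 i.
  have : diag_mx d = U *m S *m U ^t*.
    by rewrite [in RHS]SE !mulmxA mulmxV// mul1mx -mulmxA (unitarymxP Uu) mulmx1.
  move=> /matrixP/(_ i i); rewrite [LHS]mxE eqxx mulr1n => ->.
  have -> : (U *m S *m U ^t*) i i = (row i U *m S *m (row i U) ^t*) 0 0.
    rewrite -row_mul !mxE; apply: eq_bigr => j _; by rewrite !mxE.
  apply: Spos; apply: contraTneq Uunit => e.
  rewrite -row_free_unit; apply/row_freePn; exists i.
  by rewrite e sub0mx.
(* The eigenvalues [d] of [S] are positive, so their square roots give an invertible [T] with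
   [S = T ^t* *m T]. *)
pose s := map_mx sqrtC d.
pose T := diag_mx s *m U.
have sunit : diag_mx s \in unitmx.
  rewrite unitmxE det_diag unitfE; apply/prodf_neq0 => i _.
  by rewrite mxE sqrtC_eq0 gt_eqF.
have Tunit : T \in unitmx by rewrite unitmx_mul sunit.
have SJ : (diag_mx s) ^t* = diag_mx s.
  apply/matrixP => i j; rewrite !mxE eq_sym; case: eqP => [->|]; last by rewrite conjC0.
  by rewrite !mulr1n; apply/CrealP/ger0_real; rewrite sqrtC_ge0 ltW.
have STT : S = T ^t* *m T.
  rewrite /T trmx_mul map_mxM SJ -(invmx_unitary Uu) [LHS]SE !mulmxA; congr (_ *m _).
  rewrite -!mulmxA; congr (_ *m _); rewrite mulmx_diag.
  by congr diag_mx; apply/rowP => i; rewrite !mxE -expr2 sqrtCK.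
set T' := T ^t*.
have T'unit : T' \in unitmx by rewrite map_unitmx unitmx_tr.
pose N := invmx T' *m A *m T'.
have invJ : (invmx T') ^t* = invmx T.
  by rewrite trmx_inv map_invmx /T' trmxCK.
(* Clearing [T] and [T'] turns this into the hypothesis relating [A] and [S]. Being proportional to
   its adjoint, [N] commutes with it. *)
have NE : N = c *: N ^t*.
  rewrite /N !trmx_mul !map_mxM invJ /T' trmxCK -/T'.
  apply: (can_inj (mulmxK Tunit)); rewrite -scalemxAl -!mulmxA mulVmx// mulmx1.
  apply: (can_inj (mulKmx T'unit)); rewrite mulmxA mulmxV// mul1mx -STT AS STT.
  by rewrite -scalemxAr !mulmxA.
have Nnormal : N \is normalmx.
  by apply/normalmxP; rewrite {1 4}NE -scalemxAl -scalemxAr.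
have NS := orthomx_spectralP Nnormal.
set V := spectralmx N in NS; have Vunit : V \in unitmx by apply: spectral_unit.
have Punit : V *m invmx T' \in unitmx by rewrite unitmx_mul Vunit unitmx_inv.
exists (V *m invmx T') => //; apply/(diagonalizable_forLR Punit).
exists (spectral_diag N); rewrite mxpoly.conjVmx//.
apply: (can_inj (mulKmx Punit)).
rewrite [RHS]mulmxA [X in _ = X *m _]mulmxA (mulmxV Punit) mul1mx !mulmxA.
have -> : V *m invmx T' *m A = V *m N *m invmx T'.
  by rewrite /N !mulmxA mulmxK.
by rewrite {1}NS !mulmxA mulmxV// mul1mx.
Qed.

(** A real positive definite [G] stays so as a hermitian form: for [v = a + i b] the cross terms
    cancel by symmetry. The scalar [s] covers symmetric and skew operators at once. *)
Lemma diagonalizable_complexification (R : rcfType) n (G A : 'M[R]_n) (s : R) :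
  G^T = G -> (forall v : 'rV_n, v != 0 -> 0 < (v *m G *m v^T) 0 0) ->
  A *m G = s *: (G *m A^T) -> diagonalizable (map_mx (real_complex R) A).
Proof.
move=> Gsym Gpos AG.
have conjR m1 m2 (M : 'M[R]_(m1, m2)) :
    (map_mx (real_complex R) M) ^t* = map_mx (real_complex R) M^T.
  by apply/matrixP => i j; rewrite !mxE; apply: conjc_real.
apply: (@diagonalizable_selfadjoint_up_to_scalar _ _
  (map_mx (real_complex R) G) _ (real_complex R s)); first by rewrite conjR Gsym.
  move=> v vn0; pose a := map_mx (@complex.Re R) v; pose b := map_mx (@complex.Im R) v.
  have vE : v = map_mx (real_complex R) a + 'i%C *: map_mx (real_complex R) b.
    by apply/matrixP => i j; rewrite !mxE [LHS]complexE.
  have sym : b *m G *m a^T = a *m G *m b^T.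
    have <- : (b *m G *m a^T)^T = a *m G *m b^T by rewrite !trmx_mul trmxK Gsym mulmxA.
    by apply/matrixP => i j; rewrite !ord1 [RHS]mxE.
  have -> : v *m map_mx (real_complex R) G *m v ^t* =
      map_mx (real_complex R) (a *m G *m a^T + b *m G *m b^T).
    have vJ : v ^t* = map_mx (real_complex R) a^T - 'i%C *: map_mx (real_complex R) b^T.
      apply/matrixP => i j; rewrite !mxE.
      case: (v j i) => x y; rewrite -[LHS]/(conjc _); apply/eqP.
      rewrite eq_complex /=.
      by rewrite !(mul0r, mul1r, mulr0, subr0, sub0r, addr0, add0r, oppr0) !eqxx.
    rewrite vJ {1}vE !mulmxDl !mulmxBr -!scalemxAl -!scalemxAr -!map_mxM sym.
    rewrite scalerA -expr2 sqr_i scaleN1r opprK map_mxD.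
    by rewrite addrA subrK.
  rewrite mxE ltcR mxE.
  have pos (w : 'rV[R]_n) : 0 <= (w *m G *m w^T) 0 0.
    have [->|/Gpos/ltW//] := eqVneq w 0; by rewrite !mul0mx mxE.
  have [a0|/Gpos a0] := eqVneq a 0; last by rewrite ltr_pwDl.
  rewrite ltr_pwDr// Gpos//; apply: contraNneq vn0 => b0.
  by rewrite vE a0 b0 !map_mx0 scaler0 addr0.
by rewrite conjR -!map_mxM AG map_mxZ.
Qed.

End Diagonalizable.

(** * Coordinates of vectors and subspaces *)

Section Coordinates.
Context {F : fieldType} {V : vectType F}.
Local Notation n := (\dim {:V}).
Local Notation e := (vbasis {:V}).
Implicit Types (U : {vspace V}).

Definition basis_mx U : 'M[F]_(\dim U, n) := \matrix_i rVof e (vbasis U)`_i.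

Lemma mul_basis_mx U (v : 'rV_(\dim U)) :
  v *m basis_mx U = rVof e (\sum_i v 0 i *: (vbasis U)`_i).
Proof.
by rewrite mulmx_sum_row linear_sum; apply: eq_bigr => i _; rewrite rowK linearZ.
Qed.

Lemma basis_mx_free U : row_free (basis_mx U).
Proof.
apply: inj_row_free => v; rewrite mul_basis_mx => /eqP.
rewrite rVof_eq0 ?vbasisP// => /eqP v0; apply/rowP => i; rewrite [RHS]mxE.
by have /freeP -> := basis_free (vbasisP U).
Qed.

Lemma rVof_sub_basis_mx U x : (rVof e x <= basis_mx U)%MS = (x \in U).
Proof.
apply/submxP/idP => [[v]|xU].
  rewrite mul_basis_mx => /(can_inj (rVofK (vbasisP _))) ->.
  by apply: memv_suml => i _; rewrite memvZ// vbasis_mem// mem_nth// size_tuple.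
exists (\row_i coord (vbasis U) i x); rewrite mul_basis_mx; congr rVof.
by rewrite {1}(coord_vbasis xU); apply: eq_bigr => i _; rewrite mxE.
Qed.

(** This turns dimensions of stabilizers into coranks, to which semicontinuity applies. *)
Lemma dimv_mulmx_ker U m (A : 'M[F]_(n, m)) :
  (forall x, x \in U <-> rVof e x *m A = 0) -> \dim U = (n - \rank A)%N.
Proof.
move=> UA; rewrite -mxrank_ker -(eqP (basis_mx_free U)).
apply/eqmx_rank/andP; split; apply/rV_subP => v.
  by rewrite -[v](vecofK (vbasisP _)) rVof_sub_basis_mx => /UA/sub_kermxP.
by rewrite -[v](vecofK (vbasisP _)) rVof_sub_basis_mx => /sub_kermxP/UA.
Qed.

End Coordinates.

(** * The index and matrices of bilinear forms *)

Section Index.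
Context {K : fieldType} {L : lieAlgType K}.
Local Notation n := (\dim {:L}).
Local Notation e := (vbasis {:L}).
Implicit Types (f : 'Hom(L, K^o)).

Lemma lie_index_le f : (lie_index L <= \dim (lie_stab f))%N.
Proof.
rewrite /lie_index; case: ex_minnP => m _; apply.
by apply/asboolP; exists f.
Qed.

Lemma lie_index_attained : exists f : 'Hom(L, K^o), \dim (lie_stab f) = lie_index L.
Proof. by rewrite /lie_index; case: ex_minnP => m /asboolP[f <-] _; exists f. Qed.

Definition form_mx (V : vectType K) (b : V -> V -> K) : 'M[K]_(\dim {:V}) :=
  \matrix_(i, j) b (vbasis {:V})`_i (vbasis {:V})`_j.

Lemma mul_form_mx (V : vectType K) (b : V -> V -> K) x j :
  (forall y, scalar (b^~ y)) ->
  (rVof (vbasis {:V}) x *m form_mx b) 0 j = b x (vbasis {:V})`_j.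
Proof.
move=> bl.
pose B y := HB.pack_for {scalar V} (b^~ y) (GRing.isLinear.Build _ _ _ _ _ (bl y)).
rewrite [in RHS](coord_vbasis (memvf x)) -[RHS]/(B _ _) linear_sum mxE.
by apply: eq_bigr => i _; rewrite linearZ !mxE.
Qed.

Lemma mul_form_mx2 (V : vectType K) (b : V -> V -> K) x y :
  (forall y, scalar (b^~ y)) -> (forall x, scalar (b x)) ->
  (rVof (vbasis {:V}) x *m form_mx b *m (rVof (vbasis {:V}) y)^T) 0 0 = b x y.
Proof.
move=> bl br.
pose B := HB.pack_for {scalar V} (b x) (GRing.isLinear.Build _ _ _ _ _ (br x)).
rewrite [in RHS](coord_vbasis (memvf y)) -[RHS]/(B _) linear_sum mxE.
apply: eq_bigr => j _; rewrite linearZ mul_form_mx// !mxE; exact: mulrC.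
Qed.

Lemma form_mx_ker (V : vectType K) (b : V -> V -> K) x :
  (forall y, scalar (b^~ y)) -> (forall x, scalar (b x)) ->
  (forall y, b x y = 0) <-> rVof (vbasis {:V}) x *m form_mx b = 0.
Proof.
move=> bl br; split=> [bx0|x0 y].
  by apply/rowP => j; rewrite mul_form_mx// bx0 mxE.
by rewrite -mul_form_mx2// x0 mul0mx mxE.
Qed.

End Index.

(** * Contraction of the Lie algebra to the semidirect product *)

Section Contraction.
Context {K : numFieldType} {g : lieAlgType K} {k p : {vspace g}}.
Context (kk : is_subalgebra k).
Context (kp : forall x y : g, x \in k -> y \in p -> ⁅x, y⁆ \in p).
Context (pp : forall x y : g, x \in p -> y \in p -> ⁅x, y⁆ \in k).
Context (kDp : (k + p = fullv)%VS) (kIp : (k :&: p = 0)%VS).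
Local Notation S := (semidirect kk kp).
Implicit Types u v : S.

(** For [c != 0] this is a linear isomorphism onto [g]; the brackets pulled back along it form the
    Inönü-Wigner contraction of [g] along [k], with the semidirect product as limit at [c = 0]. *)
Definition rescale (c : K) u : g := c *: vsval u.1 + vsval u.2.

Fact rescale_linear c : linear (rescale c).
Proof.
move=> a u v; rewrite /rescale.
have -> : vsval (a *: u + v).1 = a *: vsval u.1 + vsval v.1 by exact: linearP.
have -> : vsval (a *: u + v).2 = a *: vsval u.2 + vsval v.2 by exact: linearP.
by rewrite !scalerDr addrACA !scalerA mulrC.
Qed.
HB.instance Definition _ c :=
  GRing.isLinear.Build K S g *:%R (rescale c) (rescale_linear c).

Lemma rescale_lie c u v :
  ⁅rescale c u, rescale c v⁆ =
  rescale c ⁅u, v⁆ + c ^+ 2 *: ⁅vsval u.1, vsval v.1⁆.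
Proof.
rewrite /rescale -[⁅u, v⁆]/(semidirect_lie u v) semidirect_lie1 semidirect_lie2.
rewrite !lieDl !lieZl !linearD !linearZ /= scalerA -expr2.
rewrite [⁅vsval v.2, _⁆]lieC opprK -addrA addrC; congr (_ + _).
by rewrite addrA [_ *: _ + c *: _]addrC.
Qed.

Lemma rescale_ker0 c : c != 0 -> lker (linfun (rescale c)) == 0%VS.
Proof.
move=> c0; rewrite -subv0; apply/subvP => u; rewrite memv_ker lfunE /= memv0 => /eqP.
case: u => x s /eqP; rewrite /rescale /= addr_eq0 => /eqP e.
have s0 : vsval s = 0.
  apply/eqP; rewrite -memv0 -kIp memv_cap subvsP /= -[vsval s]opprK -e.
  by rewrite memvN memvZ// subvsP.
move: e; rewrite s0 oppr0 => /eqP; rewrite scaler_eq0 (negPf c0) /= => /eqP x0.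
apply/eqP; congr (_, _); exact: subvs_inj.
Qed.

Lemma rescale_surj c x : c != 0 -> exists u, x = rescale c u.
Proof.
move=> c0; have : x \in (k + p)%VS by rewrite kDp memvf.
case/memv_addP => s sk [y yp ->]; exists (vsproj p (c^-1 *: y), vsproj k s).
by rewrite /rescale /= !vsprojK ?memvZ// scalerA mulfV// scale1r addrC.
Qed.

(* Transporting [f] by [rescale c] turns the form of [g] into a polynomial
   deformation, in the variable [c ^+ 2], of the form of the semidirect
   product. *)
Lemma lie_stab_contraction (f : 'Hom(S, K^o)) :
  exists f' : 'Hom(g, K^o), (\dim (lie_stab f') <= \dim (lie_stab f))%N.
Proof.
(* [w] is the form of [f] on the semidirect product; [z] records the brackets of two elements of
   [p], which the semidirect product forgets. *)
pose w u v : K := f ⁅u, v⁆.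
pose z u v : K := f (0, vsproj k ⁅vsval u.1, vsval v.1⁆).
have wl v : scalar (w^~ v) by move=> a u u'; rewrite /w lieDl lieZl linearP.
have wr u : scalar (w u) by move=> a v v'; rewrite /w !linearP.
have zP (x x' : g) a : f (0, vsproj k (a *: x + x')) =
    a * f (0, vsproj k x) + f (0, vsproj k x').
  transitivity (f (a *: ((0, vsproj k x) : S) + ((0, vsproj k x') : S))).
    congr (f _); rewrite linearP; apply: (congr2 pair) => //.
    by rewrite /= scaler0 addr0.
  by rewrite linearP.
have zl v : scalar (z^~ v) by move=> a u u'; rewrite /z -zP lieDl lieZl.
have zr u : scalar (z u) by move=> a v v'; rewrite /z -zP linearP.
pose M : 'M[{poly K}]_(\dim {:S}) :=
  map_mx polyC (form_mx w) + 'X *: map_mx polyC (form_mx z).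
have ME t : map_mx (horner_eval t) M = form_mx (fun u v => w u v + t * z u v).
  by apply/matrixP => i j; rewrite !mxE /= horner_evalE !hornerE.
have [d d0 dP] := mxrank_horner_semicontinuous M 0.
(* The parameter of the pencil has to be a nonzero square [c ^+ 2], hence the composition with
   ['X^2]. *)
have [|m] := @exists_nonroot _ (d \Po 'X^2).
  apply: contraNneq d0 => /(congr1 (fun q => q.[0])).
  by rewrite horner_comp !hornerE expr0n => ->.
set c : K := m.+1%:R; rewrite horner_comp !hornerE => /dP rkM.
have c0 : c != 0 by rewrite pnatr_eq0.
pose phi : 'Hom(S, g) := linfun (rescale c).
have phiE u : phi u = rescale c u by rewrite lfunE.
have phiK := lker0_lfunK (rescale_ker0 c0).
pose f' := (f \o phi^-1)%VF; exists f'.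
have f'E u v : f' ⁅phi u, phi v⁆ = w u v + c ^+ 2 * z u v.
  have e : ⁅phi u, phi v⁆ = phi (⁅u, v⁆ + c ^+ 2 *: (0, vsproj k ⁅vsval u.1, vsval v.1⁆)).
    rewrite !phiE rescale_lie linearD linearZ; congr (_ + _ *: _).
    have v0 : vsval (0 : subvs_of p) = 0 by exact: linear0.
    by rewrite -[RHS]/(c *: vsval 0 + vsval (vsproj k _)) v0 scaler0 add0r vsprojK//
      pp ?subvsP.
  by rewrite /f' comp_lfunE e phiK [in LHS]addrC linearP addrC.
pose r u v := w u v + c ^+ 2 * z u v.
have rl v : scalar (r^~ v).
  by move=> a u u'; rewrite /r wl zl mulrDr mulrDr addrACA mulrCA.
have rr u : scalar (r u).
  by move=> a v v'; rewrite /r wr zr mulrDr mulrDr addrACA mulrCA.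
(* Pulled back by [phi], the stabilizer of [f'] is the radical of [r], so both dimensions become
   coranks of matrices over the same basis of [S]. *)
rewrite -(limg_dim_eq (f := (phi^-1)%VF) (U := lie_stab f')); last first.
  apply/eqP; rewrite -subv0; apply/subvP => x; rewrite memv_cap memv0 => /andP[_].
  have [u ->] := rescale_surj x c0; rewrite -phiE memv_ker phiK => /eqP ->.
  by rewrite linear0 eqxx.
have -> : \dim (lie_stab f) = (\dim {:S} - \rank (form_mx w))%N.
  by apply: dimv_mulmx_ker => u; rewrite -form_mx_ker//; split=> /lie_stabP.
have wM : form_mx w = map_mx (horner_eval 0) M.
  by rewrite ME; apply/matrixP => i j; rewrite !mxE mul0r addr0.
rewrite (@dimv_mulmx_ker _ _ _ _ (form_mx r)); first by rewrite leq_sub2l// wM -ME.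
move=> u; rewrite -form_mx_ker//; split=> [/memv_imgP[x /lie_stabP xf ->] v|ru].
  have [u' ux] := rescale_surj x c0; rewrite -phiE in ux.
  by rewrite ux phiK /r -f'E -ux.
apply/memv_imgP; exists (phi u); last by rewrite phiK.
apply/lie_stabP => y; have [v ->] := rescale_surj y c0.
by rewrite -phiE f'E -/(r u v).
Qed.

End Contraction.

(** * Adjoint matrices, the Killing form and gradients of trace invariants *)

Section AdjointMatrix.
Context {K : numFieldType} {L : lieAlgType K}.
Local Notation n := (\dim {:L}).
Local Notation e := (vbasis {:L}).
Implicit Types (x y z : L) (U : {vspace L}).

Definition ad_mx x : 'M[K]_n := mxof e e (ad x).

Fact ad_mx_linear : linear ad_mx.
Proof. by move=> a x y; rewrite /ad_mx ad_linear linearP. Qed.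
HB.instance Definition _ := GRing.isLinear.Build K L 'M[K]_n *:%R ad_mx ad_mx_linear.

Lemma rVof_lie x y : rVof e ⁅x, y⁆ = rVof e y *m ad_mx x.
Proof. by rewrite -rVof_app ?vbasisP// adE. Qed.

Lemma rVofI x y : rVof e x = rVof e y -> x = y.
Proof. exact: (can_inj (rVofK (vbasisP _))). Qed.

Lemma lie_lie x y z : ⁅⁅x, y⁆, z⁆ = ⁅x, ⁅y, z⁆⁆ - ⁅y, ⁅x, z⁆⁆.
Proof.
have /eqP := lie_jacobi x y z; rewrite addr_eq0 => /eqP J.
by rewrite [LHS]lieC -J [⁅z, x⁆]lieC linearN.
Qed.

(** Matrices act on row vectors from the right, so products appear in the order opposite to
    composition. *)
Lemma ad_mx_lie x y : ad_mx ⁅x, y⁆ = ad_mx y *m ad_mx x - ad_mx x *m ad_mx y.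
Proof.
apply/row_matrixP => i; rewrite !rowE -[delta_mx 0 i](vecofK (vbasisP _)).
set u := vecof _ _.
by rewrite mulmxBr !mulmxA -!rVof_lie lie_lie linearB.
Qed.

Lemma ad_mx_comm x y : ⁅x, y⁆ = 0 -> comm_mx (ad_mx x) (ad_mx y).
Proof.
move=> xy0; apply/eqP; rewrite /comm_mx eq_sym -subr_eq0 -ad_mx_lie xy0.
by rewrite linear0.
Qed.

Lemma killingE x y : killing x y = \tr (ad_mx y *m ad_mx x).
Proof. by rewrite /killing (mxof_comp _ _ (vbasisP _)). Qed.

Lemma killingC x y : killing x y = killing y x.
Proof. by rewrite !killingE mxtrace_mulC. Qed.

Lemma killing_linearr x : scalar (killing x).
Proof. by move=> a y z; rewrite !killingE !linearP mulmxDl -scalemxAl !linearP. Qed.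

Lemma killing_linearl y : scalar (killing^~ y).
Proof. by move=> a x z; rewrite /= ![killing _ y]killingC killing_linearr. Qed.

Lemma killingZr a x y : killing x (a *: y) = a * killing x y.
Proof. by rewrite !killingE linearZ -scalemxAl linearZ. Qed.

Lemma killing0r x : killing x 0 = 0.
Proof. by rewrite -(scale0r 0) killingZr mul0r. Qed.

Lemma killingNl x y : killing (- x) y = - killing x y.
Proof. by rewrite !killingE linearN mulmxN linearN. Qed.

Lemma killingDr x y z : killing x (y + z) = killing x y + killing x z.
Proof. by rewrite -[y]scale1r killing_linearr mul1r scale1r. Qed.

Lemma killing_lie x y z : killing ⁅x, y⁆ z = killing x ⁅y, z⁆.
Proof.
rewrite !killingE !ad_mx_lie mulmxBr mulmxBl !linearB /= !mulmxA; congr (_ - _).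
by rewrite mxtrace_mulC mulmxA.
Qed.

(** The matrix of [theta] is its own inverse and conjugates [ad_mx x] into [ad_mx (theta x)]; traces
    do not see conjugation. *)
Lemma killing_automorphism (theta : 'End(L)) x y :
  (forall u v, theta ⁅u, v⁆ = ⁅theta u, theta v⁆) -> cancel theta theta ->
  killing (theta x) (theta y) = killing x y.
Proof.
move=> thM thK; pose Th := mxof e e theta.
have ThTh : Th *m Th = 1%:M.
  rewrite /Th -(mxof_comp _ _ (vbasisP _)) (_ : (theta \o theta)%VF = \1%VF).
    by rewrite mxof1// (basis_free (vbasisP _)).
  by apply/lfunP => u; rewrite comp_lfunE thK id_lfunE.
have E u : ad_mx (theta u) = Th *m ad_mx u *m Th.
  rewrite /ad_mx /Th -!(mxof_comp _ _ (vbasisP _)); congr mxof; apply/lfunP => v.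
  by rewrite !comp_lfunE !adE thM thK.
rewrite !killingE !E -!mulmxA [Th *m (Th *m _)]mulmxA ThTh mul1mx.
by rewrite mxtrace_mulC -!mulmxA ThTh mulmx1.
Qed.

(* Column [j] is the coordinate vector of the linear form [tr (ad z ^ j ad _)],
   the differential at [z] of an invariant polynomial up to a scalar. *)
Definition trace_mx N z : 'M[K]_(n, N) :=
  \matrix_(i, j) \tr (ad_mx z ^+ j *m ad_mx e`_i).

Lemma mul_trace_mx N z y (j : 'I_N) :
  (rVof e y *m trace_mx N z) 0 j = \tr (ad_mx z ^+ j *m ad_mx y).
Proof.
rewrite [in RHS](coord_vbasis (memvf y)) mxE !linear_sum.
apply: eq_bigr => i _.
by rewrite linearZ /= -scalemxAr linearZ !mxE.
Qed.

(** Cyclicity of the trace makes each form [tr (ad z ^ j ad _)] vanish on all brackets with [z]. *)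
Lemma ad_mx_trace_mx N z : ad_mx z *m trace_mx N z = 0.
Proof.
apply/row_matrixP => i; rewrite row0 rowE -[delta_mx 0 i](vecofK (vbasisP _)).
rewrite mulmxA -rVof_lie; apply/rowP => j; rewrite mul_trace_mx mxE ad_mx_lie.
rewrite mulmxBr linearB /= mulmxA mxtrace_mulC !mulmxA -[_ *m ad_mx z ^+ j]exprS.
by rewrite exprSr subrr.
Qed.

(** On the line from [z0] to [z], a generic point has trace matrix of rank at least that at [z0] and
    adjoint matrix of rank at least that at [z]. At that point the product of the two matrices is
    zero, which bounds the sum of their ranks by [n]. *)
Lemma rank_trace_mx_le N z0 z : (\rank (trace_mx N z0) <= n - \rank (ad_mx z))%N.
Proof.
pose Z : 'M[{poly K}]_n :=
  map_mx polyC (ad_mx z0) + 'X *: map_mx polyC (ad_mx (z - z0)).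
have ZE t : map_mx (horner_eval t) Z = ad_mx (z0 + t *: (z - z0)).
  rewrite linearD linearZ; apply/matrixP => i j.
  by rewrite !mxE /= horner_evalE !hornerE.
pose T : 'M[{poly K}]_(n, N) :=
  \matrix_(i, j) \tr (Z ^+ j *m map_mx polyC (ad_mx e`_i)).
have TE t : map_mx (horner_eval t) T = trace_mx N (z0 + t *: (z - z0)).
  apply/matrixP => i j; rewrite !mxE -trace_map_mx map_mxM rmorphXn /= ZE.
  rewrite -map_mx_comp (_ : map_mx _ _ = ad_mx e`_i)//.
  by apply/matrixP => i' j'; rewrite mxE /= horner_evalE hornerC.
have [d d0 dP] := mxrank_horner_semicontinuous T 0.
have [d' d'1 d'P] := mxrank_horner_semicontinuous Z 1.
have [|m] := @exists_nonroot _ (d * d').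
  rewrite mulf_neq0//; first by apply: contraNneq d0 => ->; rewrite horner0.
  by apply: contraNneq d'1 => ->; rewrite horner0.
rewrite hornerM mulf_eq0 negb_or => /andP[/dP + /d'P].
rewrite !TE !ZE scale0r addr0 scale1r [z0 + (z - z0)]addrC subrK => le1 le2.
apply: leq_trans le1 (leq_trans _ (leq_sub2l _ le2)).
by rewrite leq_subRL ?rank_leq_row// mulmx0_rank_max// ad_mx_trace_mx.
Qed.

(** Nondegeneracy writes [f] as [killing z], and invariance then identifies its stabilizer with the
    centralizer of [z]. *)
Lemma dim_lie_stab_killing (f : 'Hom(L, K^o)) :
  (forall x, (forall y, killing x y = 0) -> x = 0) ->
  exists z, \dim (lie_stab f) = (n - \rank (ad_mx z))%N.
Proof.
move=> nondeg; pose G := form_mx (@killing K L).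
have Gunit : G \in unitmx.
  rewrite -row_free_unit; apply: inj_row_free => v.
  rewrite -[v](vecofK (vbasisP _)) => /form_mx_ker h.
  rewrite (nondeg (vecof e v)) ?linear0// => y.
  by apply: h; [exact: killing_linearl|exact: killing_linearr].
pose z := vecof e ((\row_j f e`_j) *m invmx G).
have fz y : f y = killing z y.
  pose B := HB.pack_for {scalar L} (killing z)
    (GRing.isLinear.Build _ _ _ _ _ (killing_linearr z)).
  rewrite (coord_vbasis (memvf y)) -[RHS]/(B _) !linear_sum; apply: eq_bigr => j _.
  rewrite !linearZ /= -mul_form_mx; last exact: killing_linearl.
  by rewrite vecofK ?vbasisP// mulmxKV// mxE.
exists z; apply: dimv_mulmx_ker => x; rewrite -rVof_lie.
split=> [/lie_stabP xf|/eqP].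
  apply/eqP; rewrite rVof_eq0 ?vbasisP//; apply/eqP/nondeg => y.
  by rewrite killing_lie -fz xf.
rewrite rVof_eq0 ?vbasisP// => /eqP zx0; apply/lie_stabP => y.
by rewrite fz -killing_lie zx0 killingC killing0r.
Qed.

End AdjointMatrix.

(** * Maximal abelian subspaces *)

Definition lie_abelian (K : fieldType) (L : lieAlgType K) (U : {vspace L}) :=
  forall x y, x \in U -> y \in U -> ⁅x, y⁆ = 0.

(** [T] is taken of largest dimension; adjoining an [x] that commutes with [A + T] cannot enlarge
    it. The parameter [A] allows two uses: [A = 0] inside [p], then the resulting subspace as [A]
    inside [k]. *)
Lemma exists_maximal_abelian (K : fieldType) (L : lieAlgType K)
    (A U : {vspace L}) : lie_abelian A ->
  exists T : {vspace L}, [/\ (T <= U)%VS, lie_abelian (A + T)%VS &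
    forall x, x \in U -> (forall y, y \in (A + T)%VS -> ⁅y, x⁆ = 0) -> x \in T].
Proof.
move=> Aab.
pose P m := `[< exists T : {vspace L},
  [/\ (T <= U)%VS, lie_abelian (A + T)%VS & \dim T = m] >].
have P0 : exists m, P m.
  exists (\dim (0%VS : {vspace L})); apply/asboolP; exists 0%VS.
  by split; rewrite ?sub0v// addv0.
have Pmax m : P m -> (m <= \dim U)%N by move=> /asboolP[T [TU _ <-]]; apply: dimvS.
case: (ex_maxnP P0 Pmax) => _ /asboolP[T [TU ATab <-]] Tmax.
exists T; split=> // x xU xc.
have ab' : lie_abelian (A + (T + <[x]>))%VS.
  rewrite addvA => x1 x2 /memv_addP[u uAT [_ /vlineP[a ->] ->]].
  case/memv_addP=> [v vAT [_ /vlineP[b ->] ->]].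
  have xv0 : ⁅x, v⁆ = 0 by rewrite lieC xc// oppr0.
  rewrite lieDl !linearD /= !lieZl !linearZ /= ATab// xc// xv0 liexx.
  by rewrite !scaler0 !addr0.
have le1 : (T <= T + <[x]>)%VS by apply: addvSl.
have /eqP -> : T == (T + <[x]>)%VS.
  rewrite eqEdim le1 Tmax//; apply/asboolP; exists (T + <[x]>)%VS; split=> //.
  by rewrite subv_add TU -memvE.
by rewrite memvE addvSr.
Qed.

(** * Weights and generic elements for a Cartan involution *)

Section Cartan.
Context {R : realType} {g : lieAlgType R} {theta : 'End(g)}.
Context (theta_cartan : cartan_involution theta).
Local Notation n := (\dim {:g}).
Local Notation e := (vbasis {:g}).
Implicit Types (x y z : g).

Let thM x y : theta ⁅x, y⁆ = ⁅theta x, theta y⁆. Proof. by case: theta_cartan. Qed.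
Let thK : cancel theta theta. Proof. by case: theta_cartan. Qed.

Definition cartan_form x y : R := - killing x (theta y).

Lemma cartan_form_gt0 x : x != 0 -> 0 < cartan_form x x.
Proof. by case: theta_cartan => _ _; apply. Qed.

Lemma killing_theta x y : killing (theta x) y = killing x (theta y).
Proof. by rewrite -{1}[y]thK killing_automorphism. Qed.

Lemma cartan_formC x y : cartan_form x y = cartan_form y x.
Proof. by rewrite /cartan_form killingC killing_theta. Qed.

Lemma cartan_form_linearr x : scalar (cartan_form x).
Proof.
by move=> a y z; rewrite /cartan_form linearP killing_linearr opprD mulrN.
Qed.

Lemma cartan_form_linearl y : scalar (cartan_form^~ y).
Proof.
by move=> a x z; rewrite /= ![cartan_form _ y]cartan_formC cartan_form_linearr.
Qed.

Lemma killing_nondegenerate x : (forall y, killing x y = 0) -> x = 0.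
Proof.
move=> x0; apply/eqP/negPn/negP => /cartan_form_gt0.
by rewrite /cartan_form x0 oppr0 ltxx.
Qed.

(** On an eigenspace of [theta], [cartan_form] is a multiple of the Killing form. *)
Lemma killing_eigen0 (s : R) x :
  theta x = s *: x -> killing x x = 0 -> x = 0.
Proof.
move=> xs xx0; apply/eqP/negPn/negP => /cartan_form_gt0.
by rewrite /cartan_form xs killingZr xx0 mulr0 oppr0 ltxx.
Qed.

(** For [s = 1] this says that [ad x] is skew, for [s = - 1] that it is symmetric, with respect to
    the inner product. *)
Lemma cartan_form_lie (s : R) x u v : s * s = 1 -> theta x = s *: x ->
  cartan_form ⁅x, u⁆ v = - s * cartan_form u ⁅x, v⁆.
Proof.
move=> ss xs; rewrite /cartan_form thM xs lieZl killingZr mulrN mulNr opprK.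
by rewrite mulrA ss mul1r lieC killingNl opprK killing_lie.
Qed.

Lemma ad_mx_diagonalizable (s : R) x : s * s = 1 -> theta x = s *: x ->
  diagonalizable (map_mx (real_complex R) (ad_mx x)).
Proof.
move=> ss xs.
have bl := cartan_form_linearl; have br := cartan_form_linearr.
have Gsym : (form_mx cartan_form)^T = form_mx cartan_form.
  by apply/matrixP => i j; rewrite !mxE cartan_formC.
apply: (@diagonalizable_complexification _ _ (form_mx cartan_form) _ (- s)) => //.
  move=> v; rewrite -[v](vecofK (vbasisP _)) mul_form_mx2// rVof_eq0 ?vbasisP//.
  exact: cartan_form_gt0.
have E i j : (ad_mx x *m form_mx cartan_form) i j =
    cartan_form ⁅x, e`_i⁆ e`_j.
  rewrite -mul_form_mx// rVof_lie rVofE ?vbasisP// -mulmxA -rowE.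
  by rewrite [RHS]mxE.
apply/matrixP => i j; rewrite E.
have -> : form_mx cartan_form *m (ad_mx x)^T = (ad_mx x *m form_mx cartan_form)^T.
  by rewrite trmx_mul Gsym.
rewrite [RHS]mxE [X in _ * X]mxE E.
by rewrite (cartan_form_lie _ _ ss xs) cartan_formC.
Qed.

(** [lam i x] is the [i]-th diagonal entry of [ad x] in a common complex eigenbasis for [A + T]. It
    is defined on all of [g] but is a weight only on [A + T], where kernels and traces can be read
    off from it. *)
Lemma exists_weights (A T : {vspace g}) :
  (A <= leigenspace theta (- 1))%VS -> (T <= leigenspace theta 1)%VS ->
  lie_abelian (A + T)%VS ->
  exists lam : 'I_n -> g -> R[i], [/\ forall i x y, lam i (x + y) = lam i x + lam i y,
    {in (A + T)%VS &, forall u y, (forall i, lam i u = 0 -> lam i y = 0) ->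
      forall x, ⁅u, x⁆ = 0 -> ⁅y, x⁆ = 0} &
    {in (A + T)%VS &, forall z y, forall j,
      real_complex R (\tr (ad_mx z ^+ j *m ad_mx y)) = \sum_i lam i z ^+ j * lam i y}].
Proof.
move=> Ap Tk hab; set h := (A + T)%VS in hab *.
have thA x : x \in A -> theta x = - 1 *: x.
  by move=> /(subvP Ap); rewrite mem_leigenspace => /eqP.
have thT x : x \in T -> theta x = 1 *: x.
  by move=> /(subvP Tk); rewrite mem_leigenspace => /eqP.
have Ah x : x \in A -> x \in h by apply/subvP/addvSl.
have Th x : x \in T -> x \in h by apply/subvP/addvSr.
pose toC m1 m2 (M : 'M[R]_(m1, m2)) := map_mx (real_complex R) M.
(* Each of these basis vectors is an eigenvector of [theta], so its adjoint matrix is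
   diagonalizable; linearity extends the diagonal form to [A + T]. *)
pose X := vbasis A ++ vbasis T : seq g.
have Xh x : x \in X -> x \in h.
  by rewrite mem_cat => /orP[/vbasis_mem/Ah|/vbasis_mem/Th].
have [|P Punit /allP Pdiag] :=
    (codiagonalizableP [seq toC _ _ (ad_mx x) | x <- X]).1.
  split=> [_ _ /mapP[x /Xh xh ->] /mapP[y /Xh yh ->]|_ /mapP[x + ->]].
    by rewrite /comm_mx /toC -!map_mxM ad_mx_comm// hab.
  rewrite mem_cat => /orP[/vbasis_mem/thA|/vbasis_mem/thT].
    by apply: ad_mx_diagonalizable; rewrite mulrNN mulr1.
  by apply: ad_mx_diagonalizable; rewrite mulr1.
pose D x := P *m toC _ _ (ad_mx x) *m invmx P.
pose lam i x := D x i i.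
have DD x y : D (x + y) = D x + D y.
  by rewrite /D linearD /toC map_mxD mulmxDr mulmxDl.
have lamD i x y : lam i (x + y) = lam i x + lam i y by rewrite /lam DD mxE.
have DX x i j : x \in X -> i != j -> D x i j = 0.
  move=> xX ij; have /Pdiag := map_f (fun x => toC _ _ (ad_mx x)) xX.
  by move=> /(diagonalizable_forP _ Punit); apply.
have Dspan (U : {vspace g}) x i j : {subset vbasis U <= X} ->
    x \in U -> i != j -> D x i j = 0.
  move=> UX xU ij; rewrite (coord_vbasis xU) /D linear_sum /toC.
  rewrite raddf_sum mulmx_sumr mulmx_suml summxE big1// => l _.
  rewrite linearZ /= map_mxZ -scalemxAr -scalemxAl mxE -[X in _ * X]/(D _ i j).
  by rewrite DX ?mulr0// UX// mem_nth// size_tuple.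
have Ddiag x : x \in h -> D x = diag_mx (\row_i lam i x).
  move=> /memv_addP[a aA [b bT ->]]; apply/matrixP => i j.
  rewrite [RHS]mxE [X in X *+ _]mxE; case: eqP => [->|/eqP ij]; first by rewrite mulr1n.
  have AX : {subset vbasis A <= X} by move=> y yA; rewrite mem_cat yA.
  have TX : {subset vbasis T <= X} by move=> y yT; rewrite mem_cat yT orbT.
  have -> : D (a + b) i j = D a i j + D b i j by rewrite DD [LHS]mxE.
  exact: etrans (congr2 +%R (Dspan A a i j AX aA ij) (Dspan T b i j TX bT ij)) (addr0 0).
have adE x : toC _ _ (ad_mx x) = invmx P *m D x *m P.
  by rewrite /D !mulmxA mulVmx// mul1mx mulmxKV.
have ker u y : u \in h -> y \in h -> (forall i, lam i u = 0 -> lam i y = 0) ->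
    forall x, ⁅u, x⁆ = 0 -> ⁅y, x⁆ = 0.
  (* [w] holds the coordinates of [x] in the eigenbasis: [x] commutes with [u] exactly when every
     product [w 0 i * lam i u] is zero. *)
  move=> uh yh uy x ux0; pose w := toC _ _ (rVof e x) *m invmx P.
  have wE z : toC _ _ (rVof e ⁅z, x⁆) = w *m D z *m P.
    by rewrite rVof_lie /toC map_mxM -/(toC _ _ _) -/(toC _ _ _) adE !mulmxA.
  have wu0 i : w 0 i * lam i u = 0.
    have /(can_inj (mulmxK Punit)) : w *m D u *m P = 0 *m P.
      by rewrite -wE ux0 linear0 /toC map_mx0 mul0mx.
    by rewrite Ddiag// mul_mx_diag => /rowP/(_ i);
      rewrite [LHS]mxE [X in _ * X]mxE [RHS]mxE.
  apply: rVofI; apply: (map_mx_inj (f := real_complex R)); rewrite linear0 map_mx0.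
  rewrite -[LHS]/(toC _ _ _) wE Ddiag// (_ : w *m _ = 0) ?mul0mx//.
  rewrite mul_mx_diag; apply/rowP => i; rewrite [LHS]mxE [X in _ * X]mxE [RHS]mxE.
  have /eqP := wu0 i; rewrite mulf_eq0
    => /orP[/eqP->|/eqP/uy->]; by rewrite ?mul0r ?mulr0.
exists lam; split=> // z y zh yh j.
have conjM (B C : 'M_n) :
    (P *m B *m invmx P) *m (P *m C *m invmx P) = P *m (B *m C) *m invmx P.
  by rewrite !mulmxA mulmxKV.
have Dexp l : P *m toC _ _ (ad_mx z) ^+ l *m invmx P = D z ^+ l.
  elim: l => [|l IH]; first by rewrite !expr0 mulmx1 mulmxV.
  by rewrite !exprSr -IH -!mulmxE conjM.
have Dexp' l : D z ^+ l = diag_mx (\row_i lam i z ^+ l).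
  elim: l => [|l IH].
    by rewrite expr0; apply/matrixP => i i'; rewrite !mxE expr0.
  rewrite exprSr IH Ddiag// -mulmxE mulmx_diag; congr diag_mx.
  by apply/rowP => i; rewrite !mxE exprSr.
rewrite -trace_map_mx map_mxM rmorphXn /=.
have -> : \tr (map_mx (real_complex R) (ad_mx z) ^+ j *m
    map_mx (real_complex R) (ad_mx y)) =
    \tr (D z ^+ j *m D y).
  by rewrite -Dexp conjM [RHS]mxtrace_mulC mulKmx.
rewrite Dexp' Ddiag// mulmx_diag mxtrace_diag.
by apply: eq_bigr => i _; rewrite !mxE.
Qed.

Lemma exists_generic_element (A T : {vspace g}) :
  (A <= leigenspace theta (- 1))%VS -> (T <= leigenspace theta 1)%VS ->
  lie_abelian (A + T)%VS ->
  exists a b, [/\ a \in A, b \in T,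
    forall x, ⁅a, x⁆ = 0 -> forall y, y \in A -> ⁅y, x⁆ = 0,
    forall x, ⁅b, x⁆ = 0 -> forall y, y \in T -> ⁅y, x⁆ = 0 &
    (\dim (A + T) <= \rank (trace_mx n.+1 (a + b)%R))%N].
Proof.
move=> Ap Tk hab.
have [lam [lamD ker trE]] := exists_weights Ap Tk hab.
set h := (A + T)%VS in hab ker trE *.
have thA x : x \in A -> theta x = - 1 *: x.
  by move=> /(subvP Ap); rewrite mem_leigenspace => /eqP.
have thT x : x \in T -> theta x = 1 *: x.
  by move=> /(subvP Tk); rewrite mem_leigenspace => /eqP.
have Ah x : x \in A -> x \in h by apply/subvP/addvSl.
have Th x : x \in T -> x \in h by apply/subvP/addvSr.
pose I := ('I_n * 'I_n + ('I_n + 'I_n))%type.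
(* The first family separates distinct weights at [z]. The other two make the components of [z] in
   [A] and [T] generic, since [z - theta z] and [z + theta z] are twice these components. *)
pose phi (i : I) x := match i with
  | inl ij => lam ij.1 x - lam ij.2 x
  | inr (inl i) => lam i (x - theta x)
  | inr (inr i) => lam i (x + theta x)
  end.
have [||[[i j]|[i|i]] x y /=|z zh zP] := @additive_avoidance _ _ (fun x => x \in h) _ phi.
- exact: mem0v.
- by move=> x y; apply: memvD.
- by rewrite !lamD opprD addrACA.
- by rewrite -lamD [theta (x + y)]linearD opprD addrACA.
- by rewrite -lamD [theta (x + y)]linearD addrACA.
have /memv_addP[a aA [b bT zE]] := zh.
have dbl i x : lam i (x + x) = 0 -> lam i x = 0.
  by rewrite lamD -mulr2n => /eqP; rewrite mulrn_eq0 => /eqP.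
exists a, b; split=> //.
- move=> x ax0 y yA; apply: (ker a y (Ah _ aA) (Ah _ yA)) ax0 => i lia.
  have := zP (inr (inl i)); rewrite /= zE linearD /= (thA a)// (thT b)//.
  rewrite scaleN1r scale1r opprD opprK addrACA subrr addr0 lamD lia addr0.
  move=> /(_ erefl y (Ah _ yA)); rewrite (thA y)// scaleN1r opprK; exact: dbl.
- move=> x bx0 y yT; apply: (ker b y (Th _ bT) (Th _ yT)) bx0 => i lib.
  have := zP (inr (inr i)); rewrite /= zE linearD /= (thA a)// (thT b)//.
  rewrite scaleN1r scale1r addrACA subrr add0r lamD lib addr0.
  move=> /(_ erefl y (Th _ yT)); rewrite (thT y)// scale1r; exact: dbl.
rewrite -zE.
(* It suffices that no nonzero [y] in [A + T] is killed by all the forms [tr (ad z ^ j ad _)]. *)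
suff /eqP rk : row_free (basis_mx h *m trace_mx n.+1 z).
  by have := mxrankM_maxr (basis_mx h) (trace_mx n.+1 z); rewrite rk.
apply: inj_row_free => v; rewrite mulmxA mul_basis_mx.
set y := \sum_i _ => yT0.
have yh : y \in h.
  by apply: memv_suml => i _; rewrite memvZ// vbasis_mem// mem_nth// size_tuple.
have power_sums (j : 'I_n.+1) : \sum_i lam i z ^+ j * lam i y = 0.
  by rewrite -trE// -mul_trace_mx yT0 mxE rmorph0.
have lamy k : lam k y = 0.
  (* [q] vanishes at the values at [z] of all weights except those agreeing with [lam k z]. It has
     at most [n] roots, so the powers 0 to [n] suffice. By genericity the remaining weights agree at
     [y], leaving a nonzero multiple of [lam k y]. *)
  pose rs := [seq lam i z | i <- enum 'I_n & lam i z != lam k z].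
  pose q := \prod_(c <- rs) ('X - c%:P).
  have sz : (size q <= n.+1)%N.
    rewrite size_prod_XsubC ltnS size_map size_filter.
    by rewrite (leq_trans (count_size _ _)) ?size_enum_ord.
  have : \sum_i q.[lam i z] * lam i y = 0.
    under eq_bigr do rewrite (horner_coef_wide _ sz) mulr_suml.
    rewrite exchange_big big1// => j _.
    under eq_bigr do rewrite -mulrA.
    by rewrite -mulr_sumr power_sums mulr0.
  rewrite (bigID (fun i => lam i z == lam k z)) /= [X in _ + X]big1 => [|i ik]; last first.
    suff /eqP -> : root q (lam i z) by rewrite mul0r.
    by rewrite root_prod_XsubC; apply: map_f; rewrite mem_filter ik mem_enum.
  rewrite addr0 (eq_bigr (fun=> q.[lam k z] * lam k y)) => [|i /eqP ik]; last first.
    rewrite ik; congr (_ * _); apply/eqP; rewrite -subr_eq0; apply/eqP.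
    by apply: (zP (inl (i, k))); rewrite //= ik subrr.
  rewrite sumr_const => /eqP; rewrite mulrn_eq0 mulf_eq0 => /or3P[|qk|/eqP//].
    by rewrite -leqn0 leqNgt => /negP[]; apply/card_gt0P; exists k; apply: eqxx.
  have : root q (lam k z) by [].
  rewrite root_prod_XsubC /rs => /mapP [l]; rewrite mem_filter => /andP[/eqP lk _] kl.
  by rewrite kl in lk.
(* All weights of [y] vanish, so comparison with [u = 0] makes [y] central, and the Killing form is
   nondegenerate. *)
have y0 : y = 0.
  apply: killing_nondegenerate => x; rewrite killingE.
  suff -> : ad_mx y = 0 by rewrite mulmx0 linear0.
  apply/row_matrixP => i; rewrite row0 rowE -[delta_mx 0 i](vecofK (vbasisP _)).
  rewrite -rVof_lie; have -> : ⁅y, vecof e (delta_mx 0 i)⁆ = 0; last exact: linear0.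
  by apply: (ker 0 y (mem0v _) yh) (lie0l _) => l _; apply: lamy.
have /row_free_inj := basis_mx_free h; apply.
by rewrite mul0mx mul_basis_mx -/y y0 linear0.
Qed.

End Cartan.

(** * Small stabilizers in the semidirect product *)

Section CartanContraction.
Context {R : realType} {g : lieAlgType R} {k p : {vspace g}}.
Context (kp_cartan : cartan_decomposition k p).
Context (kk : is_subalgebra k).
Context (kp : forall x y : g, x \in k -> y \in p -> ⁅x, y⁆ \in p).
Local Notation S := (semidirect kk kp).

Lemma cartan_lie_pp x y : x \in p -> y \in p -> ⁅x, y⁆ \in k.
Proof.
have [theta [thM _ _] [-> ->]] := kp_cartan.
rewrite !mem_leigenspace !scale1r !scaleN1r => /eqP xp /eqP yp.
by rewrite thM xp yp lieNl linearN opprK.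
Qed.

Lemma cartan_killing_eq0 x : x \in k \/ x \in p -> killing x x = 0 -> x = 0.
Proof.
have [theta thc [-> ->]] := kp_cartan; rewrite !mem_leigenspace.
by case=> /eqP; apply: killing_eigen0.
Qed.

Lemma exists_lie_stab_le_index :
  exists f : 'Hom(S, R^o), (\dim (lie_stab f) <= lie_index g)%N.
Proof.
have [kDp kIp] := cartan_directv kp_cartan.
have [theta thc [kE pE]] := kp_cartan.
have zero_ab : lie_abelian (0%VS : {vspace g}).
  by move=> x y; rewrite memv0 => /eqP-> _; rewrite lie0l.
have [A [Ap Aab Amax]] := exists_maximal_abelian p zero_ab.
rewrite add0v in Aab Amax.
have [T [Tk ATab Tmax]] := exists_maximal_abelian k Aab.
have [] := exists_generic_element thc _ _ ATab; rewrite -?kE -?pE//.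
move=> a [b [aA bT aP bP rk]].
have ap := subvP Ap _ aA; have bk := subvP Tk _ bT.
have ab0 : ⁅a, b⁆ = 0.
  by apply: ATab; [apply: (subvP (addvSl _ _))|apply: (subvP (addvSr _ _))].
pose f0 (u : S) : R^o := killing a (vsval u.1) + killing b (vsval u.2).
have f0_linear : linear f0.
  move=> c u v; rewrite /f0.
  have -> : vsval (c *: u + v).1 = c *: vsval u.1 + vsval v.1 by exact: linearP.
  have -> : vsval (c *: u + v).2 = c *: vsval u.2 + vsval v.2 by exact: linearP.
  by rewrite !killing_linearr addrACA -mulrDr.
pose fl := HB.pack_for {linear S -> R^o} f0 (GRing.isLinear.Build _ _ _ _ _ f0_linear).
pose f : 'Hom(S, R^o) := linfun fl.
have fE x s y t : f ⁅((x, s) : S), ((y, t) : S)⁆ =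
    killing a (⁅vsval s, vsval y⁆ - ⁅vsval t, vsval x⁆) +
    killing b ⁅vsval s, vsval t⁆.
  by rewrite lfunE /= /f0 semidirect_lie1 semidirect_lie2.
have vp0 : vsval (0 : subvs_of p) = 0 by exact: linear0.
have vk0 : vsval (0 : subvs_of k) = 0 by exact: linear0.
have stabP u : u \in lie_stab f -> vsval u.1 \in A /\ vsval u.2 \in T.
  case: u => x0 s0 /lie_stabP; set x := vsval x0; set s := vsval s0 => st.
  have xp : x \in p by apply: subvsP.
  have sk : s \in k by apply: subvsP.
  (* Test the stabilizer condition on [p], at the vector [⁅a, s⁆] itself. *)
  have as0 : ⁅a, s⁆ = 0.
    have asp : ⁅a, s⁆ \in p by rewrite lieC memvN kp.
    apply: cartan_killing_eq0; first by right.
    have := st (vsproj p ⁅a, s⁆, 0); rewrite fE vsprojK// vk0.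
    by rewrite lie0l subr0 linear0 killing0r addr0 -killing_lie.
  (* Now test it on [k]. *)
  have abxs t : t \in k -> killing (⁅a, x⁆ + ⁅b, s⁆) t = 0.
    move=> tk; rewrite killingC killingDr ![killing t _]killingC !killing_lie.
    have := st (0, vsproj k t); rewrite fE vsprojK// vp0 linear0.
    by rewrite add0r [⁅t, _⁆]lieC opprK.
  have axk : ⁅a, x⁆ \in k by apply: cartan_lie_pp.
  have bsk : ⁅b, s⁆ \in k by apply: kk.
  have eq0 : ⁅a, x⁆ + ⁅b, s⁆ = 0.
    by apply: cartan_killing_eq0; [left; apply: memvD|apply/abxs/memvD].
  (* Since [a] commutes with [b] and [s], it commutes with [⁅b, s⁆]. By invariance [⁅a, x⁆] is then
     orthogonal to [⁅b, s⁆], so both terms of the zero sum vanish. *)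
  have abs0 : ⁅a, ⁅b, s⁆⁆ = 0.
    by have := lie_lie a b s; rewrite ab0 as0 lie0l linear0 subr0 => <-.
  have bs0 : ⁅b, s⁆ = 0.
    apply: cartan_killing_eq0; first by left.
    have : killing ⁅a, x⁆ ⁅b, s⁆ = 0.
      by rewrite lieC killingNl killing_lie abs0 killing0r oppr0.
    have := abxs _ bsk; rewrite killingC killingDr killingC => + e0.
    by rewrite e0 add0r.
  have ax0 : ⁅a, x⁆ = 0 by rewrite bs0 addr0 in eq0.
  (* Genericity of [a] and [b] passes from commuting with them to commuting with [A] and [T], and
     maximality concludes. *)
  split; first by apply: Amax => // y; apply: aP.
  apply: Tmax => // _ /memv_addP[y yA [t tT ->]].
  by rewrite lieDl (aP _ as0)// (bP _ bs0)// addr0.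
exists f.
have [f' <-] := lie_index_attained (L := g).
have [z ->] := dim_lie_stab_killing f' (killing_nondegenerate thc).
apply: leq_trans (leq_trans rk (rank_trace_mx_le _ _ z)).
(* At [c = 1] the rescaling is the sum map, which is injective and sends the stabilizer into
   [A + T]. *)
rewrite -(limg_dim_eq (f := linfun (rescale (kk := kk) (kp := kp) 1))
  (U := lie_stab f)); last first.
  by rewrite (eqP (rescale_ker0 _ _ kIp (oner_neq0 R))) capv0.
apply/dimvS/subvP => _ /memv_imgP[u /stabP[xA sT] ->].
by rewrite lfunE /= /rescale scale1r memv_add.
Qed.

End CartanContraction.

Theorem mainTheorem5 (R : realType) (g : lieAlgType R) (k p : {vspace g})
    (simple_g : lie_simple g) (kp : cartan_decomposition k p) :
  lie_index g =
  lie_index (semidirect (cartan_subalgebra kp) (cartan_ad_stable kp)).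
Proof.
have [kDp kIp] := cartan_directv kp.
apply/eqP; rewrite eqn_leq; apply/andP; split.
  have [f <-] := lie_index_attained
    (L := semidirect (cartan_subalgebra kp) (cartan_ad_stable kp)).
  have [f' le] := lie_stab_contraction (cartan_lie_pp kp) kDp kIp f.
  exact: leq_trans (lie_index_le f') le.
have [f le] := exists_lie_stab_le_index kp (cartan_subalgebra kp) (cartan_ad_stable kp).
exact: leq_trans (lie_index_le f) le.
Qed.
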